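(* Let $\pi_1\colon B_1\to A$ and $\pi_2\colon B_2\to A$ be homomorphisms of unital rings, and let $B:=\{(b_1,b_2)\in B_1\times B_2\mid \pi_1(b_1)=\pi_2(b_2)\}$ be the pullback ring. Let $N\geq 1$ be an integer, let $E_1$, $E_2$ be left modules over $B_1$, $B_2$, respectively, with $E_i\cong B_i^N$ as left $B_i$-modules for $i\in\{1,2\}$, and let $\{\hat x_\alpha\}_{1\le\alpha\le N}$ and $\{\hat y_\beta\}_{1\le\beta\le N}$ be the corresponding bases of $E_1$ and $E_2$. Let $h\colon {\pi_1}_*E_1\to{\pi_2}_*E_2$ be an isomorphism of left $A$-modules and let $a=(a_{\alpha\beta})\in GL_N(A)$ be the matrix implementing it, i.e. $h({\pi_1}_*(\hat x_\alpha))=\sum_\beta a_{\alpha\beta}\,{\pi_2}_*(\hat y_\beta)$ for all $\alpha$. Let $E:=M(E_1,E_2,h)$ be the associated left $B$-module. Assume that $\pi_2$ is surjective, and let $c,d\in M_N(B_2)$ be matrices such that $\pi_2(c_{\alpha\beta})=a_{\alpha\beta}$ and $\pi_2(d_{\alpha\beta})=(a^{-1})_{\alpha\beta}$ for all $\alpha,\beta$. Then $$p:=\begin{bmatrix}(1,\;c(2-dc)d) & (0,\;c(2-dc)(1-dc))\\ (0,\;(1-dc)d) & (0,\;(1-dc)^2)\end{bmatrix}$$ is an idempotent matrix in $M_{2N}(B)$, and $E\cong B^{2N}p$ as left $B$-modules.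
   Context: Rings and ring homomorphisms are unital. For a ring homomorphism $f\colon R\to S$ and a left $R$-module $E$, $f_*E:=S\otimes_R E$ (a left $S$-module), and $f_*\colon E\to f_*E$ also denotes the canonical $R$-linear map $f_*(e):=1\otimes_R e$. If $E$ is free over $R$ with basis $\{\hat x_\alpha\}$, then $f_*E$ is free over $S$ with basis $\{f_*(\hat x_\alpha)\}$. For the pullback ring $B$ with projections $\mathrm{pr}_i\colon B\to B_i$, left modules $E_i$ over $B_i$, and an isomorphism $h\colon{\pi_1}_*E_1\to{\pi_2}_*E_2$ of left $A$-modules, $$M(E_1,E_2,h):=\{(\xi_1,\xi_2)\in E_1\times E_2\mid h({\pi_1}_*(\xi_1))={\pi_2}_*(\xi_2)\},$$ a left $B$-module via $b\cdot(\xi_1,\xi_2)=(\mathrm{pr}_1(b)\xi_1,\mathrm{pr}_2(b)\xi_2)$. In the $2N\times 2N$ matrix $p$, each of the four blocks is an $N\times N$ matrix. A block written $(m_1,m_2)$ with $m_1\in M_N(B_1)$, $m_2\in M_N(B_2)$ denotes the matrix whose $(\alpha,\beta)$ entry is the pair $((m_1)_{\alpha\beta},(m_2)_{\alpha\beta})\in B_1\times B_2$. Inside the blocks, $1$ and $2$ denote $I_N$ and $2I_N$, and $0$ the zero matrix. $B^{2N}$ consists of row vectors, and $B^{2N}p$ is the image of right multiplication by $p$. *)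

(* Defs.v *)
From HB Require Import structures.
From mathcomp Require Import all_boot all_algebra boolp.
From mathcomp.multinomials Require Import freeg.

Set Implicit Arguments.
Unset Strict Implicit.
Unset Printing Implicit Defensive.

Import GRing.Theory.
Local Open Scope ring_scope.
Local Open Scope quotient_scope.

(* Rings are pzRingTypes: unital, not necessarily commutative, and the zero
   ring is allowed. *)

Definition module_iso (R : pzRingType) (U V : lmodType R) : Prop :=
  exists phi : {linear U -> V}, bijective phi.

Section Pushforward.
Variables (R S : pzRingType) (f : {rmorphism R -> S}) (E : lmodType R).

(* The subgroup of the free abelian group on S * E generated by the relations
   that define the tensor product of S and E over R, where R acts on the right
   of S through f. *)
Inductive tensor_rel : {freeg (S * E)%type / int} -> Prop :=
| TensorDl s s' e :
    tensor_rel (<< (s + s', e) >> - << (s, e) >> - << (s', e) >>)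
| TensorDr s e e' :
    tensor_rel (<< (s, e + e') >> - << (s, e) >> - << (s, e') >>)
| TensorMZ s r e :
    tensor_rel (<< (s * f r, e) >> - << (s, r *: e) >>)
| Tensor0 : tensor_rel 0
| TensorB u v : tensor_rel u -> tensor_rel v -> tensor_rel (u - v).

Definition tensor_pred : {pred {freeg (S * E)%type / int}} :=
  fun u => `[< tensor_rel u >].

Lemma tensor_pred_closed : zmod_closed tensor_pred.
Proof.
split=> [|u v /asboolP uI /asboolP vI]; apply/asboolP; first exact: Tensor0.
exact: TensorB.
Qed.

HB.instance Definition _ :=
  GRing.isZmodClosed.Build _ tensor_pred tensor_pred_closed.

Definition pushforward := Quotient.quot tensor_pred.

HB.instance Definition _ := GRing.Zmodule.on pushforward.

Definition tensor (s : S) (e : E) : pushforward := \pi_pushforward << (s, e) >>.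

Definition pre_scale (t : S) :
    {freeg (S * E)%type / int} -> {freeg (S * E)%type / int} :=
  fglift (fun se => << (t * se.1, se.2) >>).

Definition push_scale (t : S) (x : pushforward) : pushforward :=
  \pi_pushforward (pre_scale t (repr x)).

Lemma pre_scaleB t : {morph pre_scale t : u v / u - v}.
Proof. by move=> u v; apply: lift_is_additive. Qed.

Lemma pre_scaleU t s e : pre_scale t << (s, e) >> = << (t * s, e) >>.
Proof. by rewrite /pre_scale liftU scale1r. Qed.

Lemma pre_scale_rel t u : tensor_rel u -> tensor_rel (pre_scale t u).
Proof.
elim=> [s s' e|s e e'|s r e||v w _ IHv _ IHw].
- by rewrite !pre_scaleB !pre_scaleU mulrDr; apply: TensorDl.
- by rewrite !pre_scaleB !pre_scaleU; apply: TensorDr.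
- by rewrite pre_scaleB !pre_scaleU mulrA; apply: TensorMZ.
- by rewrite -(subrr 0) pre_scaleB subrr; apply: Tensor0.
- by rewrite pre_scaleB; apply: TensorB.
Qed.

Lemma push_eqP u v :
  reflect (tensor_rel (u - v)) (\pi_pushforward u == \pi_pushforward v).
Proof.
apply: (iffP idP); rewrite -Quotient.idealrBE; first by move/asboolP.
by move=> uv; apply/asboolP.
Qed.

Lemma push_scale_pi t u :
  push_scale t (\pi_pushforward u) = \pi_pushforward (pre_scale t u).
Proof.
apply/eqP/push_eqP; rewrite -pre_scaleB; apply: pre_scale_rel.
by apply/push_eqP; rewrite reprK.
Qed.

Lemma push_pi_zmod_morphism : zmod_morphism \pi_pushforward.
Proof. exact: pi_is_zmod_morphism. Qed.

Lemma push_scaleB t : {morph push_scale t : x y / x - y}.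
Proof.
elim/quotW=> u; elim/quotW=> v.
by rewrite -push_pi_zmod_morphism !push_scale_pi pre_scaleB
  push_pi_zmod_morphism.
Qed.

Lemma push_scale_tensor t s e : push_scale t (tensor s e) = tensor (t * s) e.
Proof. by rewrite push_scale_pi pre_scaleU. Qed.

Lemma push_ind (P : pushforward -> Prop) :
    (forall x y, P x -> P y -> P (x - y)) -> (forall s e, P (tensor s e)) ->
  P 0 -> forall x, P x.
Proof.
move=> PB Pt P0; have PN x : P x -> P (- x).
  by move=> Px; rewrite -[- x]add0r; apply: PB.
have PD x y : P x -> P y -> P (x + y).
  by move=> Px Py; rewrite -[y]opprK; apply: PB => //; apply: PN.
have PMn x n : P x -> P (x *+ n).
  by move=> Px; elim: n => // n IHn; rewrite mulrS; apply: PD.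
elim/quotW=> u; rewrite -(freeg_sumE u) raddf_sum.
apply: big_ind => // -[s e] _ /=.
have -> (k : int) : << k *g (s, e) >> = << (s, e) >> *~ k.
  by rewrite freegU_mulz intz.
rewrite raddfMz; case: (coeff _ _) => n; first exact: PMn (Pt s e).
by rewrite NegzE mulrNz; apply/PN/PMn/Pt.
Qed.

Lemma tensorDl s s' e : tensor (s + s') e = tensor s e + tensor s' e.
Proof.
apply/eqP; rewrite -subr_eq0 opprD addrA -!push_pi_zmod_morphism.
rewrite -(subrr (tensor 0 0)) -push_pi_zmod_morphism.
by apply/push_eqP; rewrite subrr subr0; apply: TensorDl.
Qed.

Lemma tensorDr s e e' : tensor s (e + e') = tensor s e + tensor s e'.
Proof.
apply/eqP; rewrite -subr_eq0 opprD addrA -!push_pi_zmod_morphism.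
rewrite -(subrr (tensor 0 0)) -push_pi_zmod_morphism.
by apply/push_eqP; rewrite subrr subr0; apply: TensorDr.
Qed.

Lemma tensorMZ s r e : tensor (s * f r) e = tensor s (r *: e).
Proof. by apply/eqP/push_eqP; apply: TensorMZ. Qed.

Lemma push_scale0 t : push_scale t 0 = 0.
Proof. by rewrite -[X in push_scale _ X](subrr 0) push_scaleB subrr. Qed.

Lemma push_scaleA s t x : push_scale s (push_scale t x) = push_scale (s * t) x.
Proof.
elim/push_ind: x => [x y Hx Hy|u e|]; last by rewrite !push_scale0.
  by rewrite !push_scaleB Hx Hy.
by rewrite !push_scale_tensor mulrA.
Qed.

Lemma push_scale1 : left_id 1 push_scale.
Proof.
elim/push_ind=> [x y Hx Hy|u e|]; last by rewrite push_scale0.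
  by rewrite push_scaleB Hx Hy.
by rewrite push_scale_tensor mul1r.
Qed.

Lemma push_scaleDr : right_distributive push_scale +%R.
Proof.
move=> t x y; rewrite -[y in LHS]opprK push_scaleB.
by rewrite -[- y]add0r push_scaleB push_scale0 sub0r opprK.
Qed.

Lemma push_scaleDl x : {morph push_scale^~ x : s t / s + t}.
Proof.
move=> s t /=; elim/push_ind: x => [x y Hx Hy|u e|].
- by rewrite !push_scaleB Hx Hy opprD addrACA.
- by rewrite !push_scale_tensor mulrDl tensorDl.
- by rewrite !push_scale0 addr0.
Qed.

HB.instance Definition _ := GRing.Zmodule_isLmodule.Build S pushforward
  push_scaleA push_scale1 push_scaleDr push_scaleDl.

Definition push (e : E) : pushforward := tensor 1 e.

Lemma scale_tensor t s e : t *: tensor s e = tensor (t * s) e.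
Proof. exact: push_scale_tensor. Qed.

Lemma pushD : {morph push : e e' / e + e'}.
Proof. exact: tensorDr. Qed.

Lemma push_is_zmod_morphism : zmod_morphism push.
Proof.
move=> e e'; apply/eqP; rewrite -subr_eq opprK -pushD addrNK; exact: eqxx.
Qed.

HB.instance Definition _ :=
  GRing.isZmodMorphism.Build E pushforward push push_is_zmod_morphism.

Lemma pushZ r e : push (r *: e) = f r *: push e.
Proof. by rewrite scale_tensor mulr1 -[f r]mul1r tensorMZ. Qed.

End Pushforward.

Section Pullback.
Variables (A B1 B2 : pzRingType).
Variables (pi1 : {rmorphism B1 -> A}) (pi2 : {rmorphism B2 -> A}).

Definition pullback_pred : {pred (B1 * B2)%type} :=
  fun b => pi1 b.1 == pi2 b.2.

Lemma pullback_pred_closed : subring_closed pullback_pred.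
Proof.
split=> [|b b' /eqP Hb /eqP Hb'|b b' /eqP Hb /eqP Hb']; apply/eqP.
- by rewrite !rmorph1.
- by rewrite !rmorphB Hb Hb'.
- by rewrite !rmorphM Hb Hb'.
Qed.

HB.instance Definition _ :=
  GRing.isSubringClosed.Build _ pullback_pred pullback_pred_closed.

Record pullback := Pullback {
  pullback_val :> B1 * B2;
  pullback_valP : pullback_val \in pullback_pred
}.

HB.instance Definition _ := [isSub for pullback_val].
HB.instance Definition _ := [Choice of pullback by <:].
HB.instance Definition _ :=
  GRing.SubChoice_isSubPzRing.Build _ _ pullback pullback_pred_closed.

Definition pr1 (b : pullback) : B1 := (\val b).1.
Definition pr2 (b : pullback) : B2 := (\val b).2.

Section Glue.
Variables (E1 : lmodType B1) (E2 : lmodType B2).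
Variable h : {linear pushforward pi1 E1 -> pushforward pi2 E2}.

Definition glue_pred : {pred (E1 * E2)%type} :=
  fun xi => h (push pi1 xi.1) == push pi2 xi.2.

Lemma glue_pred_closed : zmod_closed glue_pred.
Proof.
split=> [|x y /eqP Hx /eqP Hy]; apply/eqP; first by rewrite !raddf0.
by rewrite /= raddfB linearB Hx Hy raddfB.
Qed.

HB.instance Definition _ :=
  GRing.isZmodClosed.Build _ glue_pred glue_pred_closed.

Record glue := Glue {
  glue_val :> E1 * E2;
  glue_valP : glue_val \in glue_pred
}.

HB.instance Definition _ := [isSub for glue_val].
HB.instance Definition _ := [Choice of glue by <:].
HB.instance Definition _ := [SubChoice_isSubZmodule of glue by <:].

Lemma glue_scale_subproof (b : pullback) (xi : glue) :
  (pr1 b *: (\val xi).1, pr2 b *: (\val xi).2) \in glue_pred.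
Proof.
apply/eqP; rewrite /= !pushZ linearZ /=.
by rewrite (eqP (valP b)) (eqP (valP xi)).
Qed.

Definition glue_scale (b : pullback) (xi : glue) : glue :=
  Glue (glue_scale_subproof b xi).

Lemma glue_scaleA a b xi :
  glue_scale a (glue_scale b xi) = glue_scale (a * b) xi.
Proof. by apply: val_inj; rewrite /= !scalerA. Qed.

Lemma glue_scale1 : left_id 1 glue_scale.
Proof.
by move=> xi; apply: val_inj; rewrite /= !scale1r; case: (glue_val xi).
Qed.

Lemma glue_scaleDr : right_distributive glue_scale +%R.
Proof. by move=> b x y; apply: val_inj; rewrite /= !scalerDr. Qed.

Lemma glue_scaleDl xi : {morph glue_scale^~ xi : a b / a + b}.
Proof. by move=> a b; apply: val_inj; rewrite /= !scalerDl. Qed.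

HB.instance Definition _ := GRing.Zmodule_isLmodule.Build pullback glue
  glue_scaleA glue_scale1 glue_scaleDr glue_scaleDl.

End Glue.
End Pullback.

Section RowImage.
Variables (R : pzRingType) (n : nat) (p : 'M[R]_n).

Definition row_image_pred : {pred 'rV[R]_n} :=
  fun v => `[< exists u : 'rV[R]_n, v = u *m p >].

Lemma row_image_pred_closed : submod_closed row_image_pred.
Proof.
split=> [|a v w /asboolP[v' ->] /asboolP[w' ->]]; apply/asboolP.
  by exists 0; rewrite mul0mx.
by exists (a *: v' + w'); rewrite mulmxDl scalemxAl.
Qed.

HB.instance Definition _ :=
  GRing.isSubmodClosed.Build R _ row_image_pred row_image_pred_closed.

Record row_image := RowImage {
  row_image_val :> 'rV[R]_n;
  row_image_valP : row_image_val \in row_image_pred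
}.

HB.instance Definition _ := [isSub for row_image_val].
HB.instance Definition _ := [Choice of row_image by <:].
HB.instance Definition _ := [SubChoice_isSubLmodule of row_image by <:].

End RowImage.

Section GlueMatrix.
Variables (B1 B2 : pzRingType) (N : nat).

Definition pair_mx (m1 : 'M[B1]_N) (m2 : 'M[B2]_N) : 'M[(B1 * B2)%type]_N :=
  \matrix_(i, j) (m1 i j, m2 i j).

(* The ring operations are those of 'M[B2]_N, so 1 and 2 denote the scalar
   matrices I_N and 2 I_N. *)
Definition glue_mx (c d : 'M[B2]_N) : 'M[(B1 * B2)%type]_(N + N) :=
  block_mx (pair_mx 1 (c * (2 - d * c) * d))
           (pair_mx 0 (c * (2 - d * c) * (1 - d * c)))
           (pair_mx 0 ((1 - d * c) * d))
           (pair_mx 0 ((1 - d * c) ^+ 2)).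

End GlueMatrix.

(* Main.v *)
(* In coordinates E is the set of pairs (v1, v2) of rows with
   pi1(v1) a = pi2(v2); this uses that the pushed-forward basis of E2 is free,
   which follows from the universal property of the tensor product.  The second
   component of p is C R, where C is the column (c (2 - d c), 1 - d c) and R the
   row (d, 1 - d c), and R C = 1; the first component is diag(1, 0).  Hence p is
   idempotent, and (v1, v2) |-> ((v1, 0), v2 R) and
   ((w, 0), w2) |-> (w, w2 C) are inverse isomorphisms between E and B^{2N} p:
   modulo the kernel of pi2, C is (a, 0) and R is (a^-1, 0), so both maps respect
   the gluing conditions. *)
Require Import Defs.
From HB Require Import structures.
From mathcomp Require Import all_boot all_algebra.
From mathcomp Require Import boolp.
From mathcomp.multinomials Require Import freeg.

Set Implicit Arguments.
Unset Strict Implicit.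
Unset Printing Implicit Defensive.

Import GRing.Theory.

Local Open Scope ring_scope.
Local Open Scope quotient_scope.

Section PushLift.
Variables (R S : pzRingType) (f : {rmorphism R -> S}).
Variables (E : lmodType R) (V : lmodType S) (g : {additive E -> V}).
Hypothesis gZ : forall r e, g (r *: e) = f r *: g e.

(** The free group has integer coefficients, so [V] is viewed as a module over the integers through
    [zmodule]. *)
Let pre_lift (u : {freeg (S * E)%type / int}) : V :=
  fglift (fun se => (se.1 *: g se.2 : zmodule V)) u.

Let pre_liftB : {morph pre_lift : u v / u - v}.
Proof. by move=> u v; exact: (@lift_is_additive _ _ (zmodule V) _ u v). Qed.

Let pre_liftU s e : pre_lift << (s, e) >> = s *: g e.
Proof. by rewrite /pre_lift liftU scale1r. Qed.

Let pre_lift_rel u : tensor_rel f u -> pre_lift u = 0.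
Proof.
elim=> [s s' e|s e e'|s r e||v w _ v0 _ w0].
- by rewrite !pre_liftB !pre_liftU scalerDl addrAC addrK subrr.
- by rewrite !pre_liftB !pre_liftU raddfD scalerDr addrAC addrK subrr.
- by rewrite pre_liftB !pre_liftU gZ scalerA subrr.
- by rewrite -(subrr 0) pre_liftB subrr.
- by rewrite pre_liftB v0 w0 subrr.
Qed.

(** Existence half of the universal property of extension of scalars: [tensor f s e] goes to
    [s *: g e], and semilinearity of [g] makes this respect the tensor relations. *)
Lemma push_lift :
  exists G : {linear pushforward f E -> V}, forall e, G (push f e) = g e.
Proof.
pose G (t : pushforward f E) : V := pre_lift (repr t).
have G_pi u : G (\pi_(pushforward f E) u) = pre_lift u.
  (* The chosen representative differs from [u] by an element of [tensor_rel], which [pre_lift]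
     kills. *)
  apply/eqP; rewrite -subr_eq0 -pre_liftB pre_lift_rel //.
  by apply/push_eqP; rewrite reprK.
have GB : {morph G : t u / t - u}.
  elim/quotW=> t; elim/quotW=> u.
  by rewrite -push_pi_zmod_morphism !G_pi pre_liftB.
have Gt s e : G (tensor f s e) = s *: g e by rewrite G_pi pre_liftU.
have G0 : G 0 = 0 by rewrite -[0 in LHS](subrr 0) GB subrr.
have GZ : scalable G.
  move=> s; elim/push_ind => [t u Ht Hu|s' e|];
    last by rewrite scaler0 G0 scaler0.
    by rewrite scalerBr !GB Ht Hu scalerBr.
  by rewrite scale_tensor !Gt scalerA.
pose GA := GRing.isZmodMorphism.Build _ _ G GB.
pose GS := GRing.isScalable.Build _ _ _ _ G GZ.
pose GL : {linear pushforward f E -> V} := HB.pack G GA GS.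
by exists GL => e; rewrite /= Gt scale1r.
Qed.

End PushLift.

Section FreeModule.
Variables (R : pzRingType) (N : nat) (E : lmodType R).
Variables (phi : {linear E -> 'rV[R]_N}) (phi_bij : bijective phi).
Variables (x : 'I_N -> E) (xE : forall i, phi (x i) = delta_mx 0 i).

Lemma free_expand e : e = \sum_i phi e 0 i *: x i.
Proof.
apply: (bij_inj phi_bij); rewrite linear_sum [LHS]row_sum_delta.
by apply: eq_bigr => i _; rewrite linearZ xE.
Qed.

Variables (S : pzRingType) (f : {rmorphism R -> S}).

Lemma push_expand e : push f e = \sum_i map_mx f (phi e) 0 i *: push f (x i).
Proof.
rewrite [e in LHS]free_expand raddf_sum.
by apply: eq_bigr => i _; rewrite /= pushZ mxE.
Qed.

(** Coordinates followed by [f] form a semilinear map on [E]; its linear extension [G] sends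
    [push f (x i)] to the i-th unit row, hence is a left inverse. *)
Lemma push_free :
  injective (fun w : 'rV[S]_N => \sum_i w 0 i *: push f (x i)).
Proof.
have gB : zmod_morphism (map_mx f \o phi).
  by move=> e e'; rewrite /= linearB map_mxB.
pose gA := GRing.isZmodMorphism.Build _ _ (map_mx f \o phi) gB.
pose g : {additive E -> 'rV[S]_N} := HB.pack (map_mx f \o phi) gA.
have gZ r e : g (r *: e) = f r *: g e by rewrite /= linearZ map_mxZ.
have [G GE] := push_lift gZ.
apply: (can_inj (g := G)) => w; rewrite linear_sum [RHS]row_sum_delta.
by apply: eq_bigr => i _; rewrite linearZ /= GE /= xE map_delta_mx.
Qed.

End FreeModule.

Section PullbackMatrix.
Variables (A B1 B2 : pzRingType).
Variables (pi1 : {rmorphism B1 -> A}) (pi2 : {rmorphism B2 -> A}).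
Notation B := (pullback pi1 pi2).

HB.instance Definition _ := GRing.RMorphism.copy (@pr1 A B1 B2 pi1 pi2)
  (fst \o val).
HB.instance Definition _ := GRing.RMorphism.copy (@pr2 A B1 B2 pi1 pi2)
  (snd \o val).

(** With the next two lemmas, a matrix over [B] is handled as a pair of matrices over [B1] and [B2]
    with the same image over [A]. *)
Lemma pullback_mxP m n (M M' : 'M[B]_(m, n)) :
  map_mx (@pr1 _ _ _ _ _) M = map_mx (@pr1 _ _ _ _ _) M' ->
  map_mx (@pr2 _ _ _ _ _) M = map_mx (@pr2 _ _ _ _ _) M' -> M = M'.
Proof.
move=> /matrixP e1 /matrixP e2; apply/matrixP=> i j; apply: val_inj.
apply: injective_projections; first by have := e1 i j; rewrite !mxE.
by have := e2 i j; rewrite !mxE.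
Qed.

Lemma pullback_mx_exists m n (M1 : 'M[B1]_(m, n)) (M2 : 'M[B2]_(m, n)) :
    map_mx pi1 M1 = map_mx pi2 M2 ->
  exists M : 'M[B]_(m, n),
    map_mx (@pr1 _ _ _ _ _) M = M1 /\ map_mx (@pr2 _ _ _ _ _) M = M2.
Proof.
move=> /matrixP e12.
have M12 i j : (M1 i j, M2 i j) \in pullback_pred pi1 pi2.
  by apply/eqP; have := e12 i j; rewrite !mxE.
by exists (\matrix_(i, j) Pullback (M12 i j)); split; apply/matrixP=> i j;
  rewrite !mxE.
Qed.

Lemma pullback_mx_compat m n (M : 'M[B]_(m, n)) :
  map_mx pi1 (map_mx (@pr1 _ _ _ _ _) M)
    = map_mx pi2 (map_mx (@pr2 _ _ _ _ _) M).
Proof. by apply/matrixP=> i j; rewrite !mxE; apply/eqP/(valP (M i j)). Qed.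

End PullbackMatrix.

Lemma pair_mxP (B1 B2 : pzRingType) m n (M M' : 'M[(B1 * B2)%type]_(m, n)) :
  map_mx fst M = map_mx fst M' -> map_mx snd M = map_mx snd M' -> M = M'.
Proof.
move=> /matrixP e1 /matrixP e2; apply/matrixP=> i j.
by apply: injective_projections; [have := e1 i j | have := e2 i j]; rewrite !mxE.
Qed.

Section GlueMatrixFactors.
Variables (B1 B2 : pzRingType) (N : nat) (c d : 'M[B2]_N).

Definition glue_col : 'M[B2]_(N + N, N) :=
  col_mx (c * (2 - d * c)) (1 - d * c).
Definition glue_row : 'M[B2]_(N, N + N) := row_mx d (1 - d * c).

(* With [u = d c], this is [u (2 - u) + (1 - u)^2 = 1]. *)
Lemma glue_row_col : glue_row *m glue_col = 1%:M.
Proof.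
rewrite mul_row_col !mulmxE mulrA.
set u := d * c; have -> : 2 - u = 1 + (1 - u) by rewrite addrA.
by rewrite mulrDr mulr1 -addrA -mulrDl !(addrC u) addrNK mul1r addrNK.
Qed.

Lemma glue_mx_fst : map_mx fst (glue_mx B1 c d) = block_mx 1%:M 0 0 0.
Proof.
by rewrite map_block_mx; congr block_mx; apply/matrixP=> i j; rewrite !mxE.
Qed.

Lemma glue_mx_snd : map_mx snd (glue_mx B1 c d) = glue_col *m glue_row.
Proof.
rewrite map_block_mx mul_col_row; congr block_mx; apply/matrixP=> i j;
  by rewrite !mxE.
Qed.

End GlueMatrixFactors.

Theorem theorem2p1
  (A B1 B2 : pzRingType)
  (pi1 : {rmorphism B1 -> A}) (pi2 : {rmorphism B2 -> A})
  (N : nat) (N_ge1 : (1 <= N)%N)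
  (E1 : lmodType B1) (E2 : lmodType B2)
  (phi1 : {linear E1 -> 'rV[B1]_N}) (phi1_bij : bijective phi1)
  (phi2 : {linear E2 -> 'rV[B2]_N}) (phi2_bij : bijective phi2)
  (x : 'I_N -> E1) (xE : forall i, phi1 (x i) = delta_mx 0 i)
  (y : 'I_N -> E2) (yE : forall i, phi2 (y i) = delta_mx 0 i)
  (h : {linear pushforward pi1 E1 -> pushforward pi2 E2}) (h_bij : bijective h)
  (a a' : 'M[A]_N) (aa' : a *m a' = 1%:M) (a'a : a' *m a = 1%:M)
  (hE : forall i, h (push pi1 (x i)) = \sum_(j < N) a i j *: push pi2 (y j))
  (pi2_surj : forall t : A, exists b : B2, pi2 b = t)
  (c d : 'M[B2]_N)
  (cE : forall i j, pi2 (c i j) = a i j)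
  (dE : forall i j, pi2 (d i j) = a' i j) :
  exists p : 'M[pullback pi1 pi2]_(N + N),
    [/\ map_mx val p = glue_mx B1 c d,
        p *m p = p
      & module_iso (glue h) (row_image p)].
Proof.
have glueP e1 e2 : h (push pi1 e1) = push pi2 e2 <->
    map_mx pi1 (phi1 e1) *m a = map_mx pi2 (phi2 e2).
  rewrite (push_expand phi1_bij xE) (push_expand phi2_bij yE) linear_sum.
  under eq_bigr => i _ do
    (rewrite linearZ /= hE scaler_sumr; under eq_bigr => j _ do rewrite scalerA).
  rewrite exchange_big /=.
  under eq_bigr => j _ do rewrite -scaler_suml.
  have -> : \sum_j (\sum_i map_mx pi1 (phi1 e1) 0 i * a i j) *: push pi2 (y j) =
      \sum_j (map_mx pi1 (phi1 e1) *m a) 0 j *: push pi2 (y j).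
    by apply: eq_bigr => j _; congr (_ *: _); rewrite mxE.
  (* Only the forward direction compares coefficients, which needs freeness. *)
  by split=> [/(push_free yE)|->].
have ca : map_mx pi2 c = a by apply/matrixP=> i j; rewrite mxE.
have da : map_mx pi2 d = a' by apply/matrixP=> i j; rewrite mxE.
have dc0 : map_mx pi2 (1 - d * c) = 0.
  by rewrite map_mxB map_mx1 map_mxM ca da a'a subrr.
have rowE : map_mx pi2 (glue_row c d) = row_mx a' 0.
  by rewrite map_row_mx da dc0.
have colE : map_mx pi2 (glue_col c d) = col_mx a 0.
  (* Writing [2 - d * c] as [1 + (1 - d * c)] lets [dc0] reduce it to 1 over [A]. *)
  have -> : glue_col c d = col_mx (c *m (1 + (1 - d * c))) (1 - d * c).
    by rewrite addrA.
  by rewrite map_col_mx map_mxM map_mxD map_mx1 dc0 addr0 mulmx1 ca.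
have [p [p1 p2]] : exists p : 'M[pullback pi1 pi2]_(N + N),
    map_mx (@pr1 _ _ _ _ _) p = block_mx 1%:M 0 0 0 /\
    map_mx (@pr2 _ _ _ _ _) p = glue_col c d *m glue_row c d.
  (* Over [A] the second component becomes diag(a a', 0) = diag(1, 0), the image of the first. *)
  apply: pullback_mx_exists.
  rewrite map_mxM rowE colE mul_col_row map_block_mx map_mx1 !map_mx0.
  by rewrite aa' !mulmx0 !mul0mx.
have pp : p *m p = p.
  apply: pullback_mxP; rewrite map_mxM ?p1 ?p2.
    by rewrite mulmx_block !mulmx0 !mul0mx mulmx1 !addr0.
  by rewrite -mulmxA (mulmxA (glue_row c d)) glue_row_col mul1mx.
have imP (r : row_image p) : val r *m p = val r.
  by case: r => r /= /asboolP[u ->]; rewrite -mulmxA pp.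
(* The graph of the isomorphism. Elements of [row_image p] are only known to exist from their two
   components, so the maps are extracted from this relation by choice at the end. *)
pose rel (xi : glue h) (r : row_image p) :=
  map_mx (@pr1 _ _ _ _ _) (val r) = row_mx (phi1 (val xi).1) 0 /\
  map_mx (@pr2 _ _ _ _ _) (val r) = phi2 (val xi).2 *m glue_row c d.
have rel_ex xi : exists r, rel xi r.
  have /eqP/glueP xiP := valP xi.
  have [w [w1 w2]] : exists w : 'rV[pullback pi1 pi2]_(N + N),
      map_mx (@pr1 _ _ _ _ _) w = row_mx (phi1 (val xi).1) 0 /\
      map_mx (@pr2 _ _ _ _ _) w = phi2 (val xi).2 *m glue_row c d.
    (* Over [A], with v1, v2 the coordinate rows of [xi]: v2 (a', 0) = v1 a (a', 0) = (v1, 0). *)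
    apply: pullback_mx_exists; rewrite map_row_mx map_mx0 map_mxM rowE -xiP.
    by rewrite mul_mx_row mulmx0 -mulmxA aa' mulmx1.
  have wp : w *m p = w.
    apply: pullback_mxP; rewrite map_mxM ?p1 ?p2 ?w1 ?w2.
      by rewrite mul_row_block !mulmx0 mulmx1 !addr0.
    by rewrite -mulmxA (mulmxA (glue_row c d)) glue_row_col mul1mx.
  have wI : w \in row_image_pred p by apply/asboolP; exists w.
  by exists (RowImage wI).
have rel_fun xi r r' : rel xi r -> rel xi r' -> r = r'.
  by move=> [e1 e2] [e1' e2']; apply/val_inj/pullback_mxP; congruence.
have rel_inj xi xi' r : rel xi r -> rel xi' r -> xi = xi'.
  rewrite /rel => -[-> ->] [/eq_row_mx[e1 _]].
  (* Multiplying by [glue_col c d] on the right cancels [glue_row c d]. *)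
  move=> /(congr1 (mulmx^~ (glue_col c d))).
  rewrite -!mulmxA glue_row_col !mulmx1 => e2.
  apply/val_inj/injective_projections.
    exact: (bij_inj phi1_bij).
  exact: (bij_inj phi2_bij).
have rel_surj r : exists xi, rel xi r.
  have [[psi1 _ psi1K] [psi2 _ psi2K]] := (phi1_bij, phi2_bij).
  pose w1 := map_mx (@pr1 _ _ _ _ _) (val r).
  pose w2 := map_mx (@pr2 _ _ _ _ _) (val r).
  (* Both this and [w2E] read off the components of [r p = r]. *)
  have w1E : w1 = row_mx (lsubmx w1) 0.
    rewrite -[in LHS](hsubmxK w1) /w1 -imP map_mxM p1 -/w1 -[w1]hsubmxK.
    by rewrite mul_row_block !mulmx0 mulmx1 !addr0 row_mxKl row_mxKr.
  have w2E : w2 = w2 *m glue_col c d *m glue_row c d.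
    by rewrite {1}/w2 -imP map_mxM p2 mulmxA.
  have xiP : (psi1 (lsubmx w1), psi2 (w2 *m glue_col c d)) \in glue_pred h.
    apply/eqP/glueP; rewrite /= psi1K psi2K map_mxM colE -pullback_mx_compat.
    by rewrite -/w1 w1E map_row_mx map_mx0 mul_row_col mulmx0 addr0 row_mxKl.
  by exists (Glue xiP); split; rewrite /= ?psi1K ?psi2K.
have [F FP] := choice rel_ex; have [G GP] := choice rel_surj.
have F_linear : linear F.
  (* By uniqueness of the related element, it suffices that [rel] is stable under linear
     combinations. *)
  move=> b xi xi'; apply: rel_fun (FP _) _.
  have [[e1 e2] [e1' e2']] := (FP xi, FP xi').
  split; rewrite /= map_mxD map_mxZ ?e1 ?e1' ?e2 ?e2' linearD linearZ.
    by rewrite scale_row_mx add_row_mx scaler0 addr0.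
  by rewrite mulmxDl scalemxAl.
pose FA := GRing.isLinear.Build _ _ _ _ F F_linear.
pose FL : {linear glue h -> row_image p} := HB.pack F FA.
exists p; split=> //.
  apply: pair_mxP; [rewrite glue_mx_fst -p1 | rewrite glue_mx_snd -p2];
    by apply/matrixP=> i j; rewrite !mxE.
exists FL; exists G => [xi|r]; first exact: rel_inj (GP _) (FP _).
exact: rel_fun (FP _) (GP _).
Qed.
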